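(* Let $G$ be a finitely generated residually finite group, and let $H$ be a finite subgroup of $G$ whose centralizer in $G$ is finite. Suppose moreover that $G$ has finitely many conjugacy classes of finite subgroups. Then the quotient map $\mathrm{Aut}(G) \to \mathrm{Out}(G)$ splits virtually. In particular $\mathrm{Out}(G)$ is residually finite.
   Context: For a group $G$, $\mathrm{Inn}(G)$ is the group of inner automorphisms and $\mathrm{Out}(G) = \mathrm{Aut}(G)/\mathrm{Inn}(G)$. A group epimorphism $f : A \to B$ splits virtually if there exist a finite index subgroup $B' < B$ and a homomorphism $g : B' \to A$ with $f \circ g = \mathrm{Id}_{B'}$. A group is residually finite if the intersection of its finite index subgroups is trivial. *)

(* Defs.v *)
From HB Require Import structures.
From mathcomp Require Import all_boot.
From mathcomp Require Import boolp classical_sets functions cardinality.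

Set Implicit Arguments.
Unset Strict Implicit.
Unset Printing Implicit Defensive.

Local Open Scope classical_set_scope.
Local Open Scope quotient_scope.
Local Open Scope group_scope.

Section Subgroups.
Context {G : groupType}.
Implicit Types (A K : set G).

Definition is_subgroup A : Prop :=
  A 1 /\ forall x y, A x -> A y -> A (x / y).

Definition finite_index A : Prop :=
  finite_set (range (fun x : G => [set x * a | a in A])).

Definition centralizer A : set G := [set x | forall a, A a -> commute x a].

Definition conj_class K : set (set G) :=
  range (fun x : G => [set k ^ x | k in K]).

End Subgroups.

Definition finitely_generated (G : groupType) : Prop :=
  exists S : set G, finite_set S /\ smallest is_subgroup S = [set: G].

Definition residually_finite (G : groupType) : Prop :=
  \bigcap_(A in [set A : set G | is_subgroup A /\ finite_index A]) A = [set 1].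

Definition finitely_many_classes_of_finite_subgroups (G : groupType) : Prop :=
  finite_set
    [set conj_class K | K in [set K : set G | is_subgroup K /\ finite_set K]].

(* Meant for surjective f. The homomorphism on B' is encoded as a total function
   of which only the restriction to B' is relevant. *)
Definition splits_virtually (A B : groupType)
    (f : UMagmaMorphism.type A B) : Prop :=
  exists B' : set B, [/\ is_subgroup B', finite_index B' &
    exists g : B -> A,
      (forall x y, B' x -> B' y -> g (x * y) = g x * g y) /\
      (forall x, B' x -> f (g x) = x)].

Record normal_subgroup (G : groupType) := NormalSubgroup {
  normal_set : set G;
  normal_is_subgroup : is_subgroup normal_set;
  normal_conj : forall x a, normal_set a -> normal_set (a ^ x)
}.

Section Quotient.
Context {G : groupType} (N : normal_subgroup G).

Definition coset_rel (x y : G) : bool := `[< normal_set N (x / y) >].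

Lemma normalV x : normal_set N x -> normal_set N x^-1.
Proof.
have [N1 NF] := normal_is_subgroup N.
by move=> Nx; rewrite -[x^-1]mul1g; apply: NF.
Qed.

Lemma normalM x y : normal_set N x -> normal_set N y -> normal_set N (x * y).
Proof.
have [N1 NF] := normal_is_subgroup N.
by move=> Nx /normalV Ny; rewrite -[y]invgK; apply: NF.
Qed.

Lemma coset_rel_refl : reflexive coset_rel.
Proof.
by move=> x; apply/asboolP; rewrite mulgV; exact: (normal_is_subgroup N).1.
Qed.

Lemma coset_rel_sym : symmetric coset_rel.
Proof.
have sym x y : coset_rel x y -> coset_rel y x.
  by move=> /asboolP /normalV Nxy; apply/asboolP; rewrite -invgF.
by move=> x y; apply/idP/idP; exact: sym.
Qed.

Lemma coset_rel_trans : transitive coset_rel.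
Proof.
move=> y x z /asboolP Nxy /asboolP Nyz; apply/asboolP.
by have := normalM Nxy Nyz; rewrite mulgA mulgVK.
Qed.

Canonical coset_equiv :=
  EquivRel coset_rel coset_rel_refl coset_rel_sym coset_rel_trans.

Definition quotient_group := {eq_quot coset_equiv}.
HB.instance Definition _ := Choice.on quotient_group.
HB.instance Definition _ := EqQuotient.on quotient_group.

Definition coset_map (x : G) : quotient_group := \pi_quotient_group x.

Lemma coset_mapP x y : reflect (normal_set N (x / y)) (coset_map x == coset_map y).
Proof. by rewrite /coset_map eqmodE /=; exact: asboolP. Qed.

Lemma coset_map_surj (q : quotient_group) : exists x, coset_map x = q.
Proof. by exists (repr q); rewrite /coset_map reprK. Qed.

Lemma coset_map_repr (x : G) : normal_set N (x / repr (coset_map x)).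
Proof. by apply/coset_mapP; rewrite /coset_map reprK. Qed.

Definition quotient_one : quotient_group := coset_map 1.
Definition quotient_mul (p q : quotient_group) : quotient_group :=
  coset_map (repr p * repr q).
Definition quotient_inv (p : quotient_group) : quotient_group :=
  coset_map (repr p)^-1.

Lemma coset_mapM x y :
  coset_map (x * y) = quotient_mul (coset_map x) (coset_map y).
Proof.
apply/eqP/coset_mapP; set x' := repr _; set y' := repr _.
have Nx : normal_set N (x / x') := coset_map_repr x.
have Ny : normal_set N (y / y') := coset_map_repr y.
have -> : x * y / (x' * y') = (y / y') ^ x^-1 * (x / x').
  by rewrite /conjg invgK invgM !mulgA mulgVK.
by apply: normalM => //; exact: normal_conj.
Qed.

Lemma coset_mapV x : coset_map x^-1 = quotient_inv (coset_map x).
Proof.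
apply/eqP/coset_mapP; set x' := repr _; rewrite invgK.
have Nx : normal_set N (x / x') := coset_map_repr x.
have -> : x^-1 * x' = ((x / x')^-1) ^ x.
  by rewrite /conjg invgF !mulgA mulgVK.
by apply: normal_conj; exact: normalV.
Qed.

Lemma quotient_mulA : associative quotient_mul.
Proof.
move=> p q r; have [x <-] := coset_map_surj p.
have [y <-] := coset_map_surj q; have [z <-] := coset_map_surj r.
by rewrite -!coset_mapM mulgA.
Qed.

Lemma quotient_mul1 : left_id quotient_one quotient_mul.
Proof.
by move=> p; have [x <-] := coset_map_surj p; rewrite -coset_mapM mul1g.
Qed.

Lemma quotient_1mul : right_id quotient_one quotient_mul.
Proof.
by move=> p; have [x <-] := coset_map_surj p; rewrite -coset_mapM mulg1.
Qed.

Lemma quotient_mulV : left_inverse quotient_one quotient_inv quotient_mul.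
Proof.
move=> p; have [x <-] := coset_map_surj p.
by rewrite -coset_mapV -coset_mapM mulVg.
Qed.

Lemma quotient_Vmul : right_inverse quotient_one quotient_inv quotient_mul.
Proof.
move=> p; have [x <-] := coset_map_surj p.
by rewrite -coset_mapV -coset_mapM mulgV.
Qed.

HB.instance Definition _ := isGroup.Build quotient_group
  quotient_mulA quotient_mul1 quotient_1mul quotient_mulV quotient_Vmul.

HB.instance Definition _ :=
  isMultiplicative.Build G quotient_group coset_map coset_mapM.
HB.instance Definition _ :=
  Multiplicative_isUMagmaMorphism.Build G quotient_group coset_map erefl.

End Quotient.

Section Automorphisms.
Variable G : groupType.

Record Aut := MkAut {
  aut_fun :> G -> G;
  autM : {morph aut_fun : x y / x * y};
  aut_bij : bijective aut_fun
}.

HB.instance Definition _ := gen_eqMixin Aut.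
HB.instance Definition _ := gen_choiceMixin Aut.

Lemma aut1 (f : Aut) : f 1 = 1.
Proof. by apply: (mulgI (f 1)); rewrite -autM !mulg1. Qed.

HB.instance Definition _ (f : Aut) := isMultiplicative.Build G G f (autM f).
HB.instance Definition _ (f : Aut) :=
  Multiplicative_isUMagmaMorphism.Build G G f (aut1 f).

Lemma autP (f g : Aut) : f =1 g -> f = g.
Proof.
case: f g => f fM fB [g gM gB] /= /funext fg; rewrite {}fg in fM fB *.
by congr MkAut; exact: Prop_irrelevance.
Qed.

Definition aut_one : Aut := @MkAut idfun (fun _ _ => erefl) (inv_bij (frefl _)).

Definition aut_mul (f g : Aut) : Aut.
Proof.
apply: (@MkAut (f \o g)); last exact: bij_comp (aut_bij f) (aut_bij g).
by move=> x y /=; rewrite !autM.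
Defined.

Definition aut_inv_fun (f : Aut) (y : G) : G := xget 1 [set x | f x = y].

Lemma aut_invK (f : Aut) : cancel (aut_inv_fun f) f.
Proof.
move=> y; rewrite /aut_inv_fun; case: xgetP => [x _ //|noinv].
by have [g _ gK] := aut_bij f; case: (noinv (g y)); exact: gK.
Qed.

Lemma autK (f : Aut) : cancel f (aut_inv_fun f).
Proof. by move=> x; apply: (bij_inj (aut_bij f)); rewrite aut_invK. Qed.

Definition aut_inv (f : Aut) : Aut.
Proof.
apply: (@MkAut (aut_inv_fun f)); last by exists f; [exact: aut_invK | exact: autK].
by move=> x y; apply: (bij_inj (aut_bij f)); rewrite autM !aut_invK.
Defined.

Lemma aut_mulA : associative aut_mul.
Proof. by move=> f g h; exact: autP. Qed.

Lemma aut_mul1 : left_id aut_one aut_mul.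
Proof. by move=> f; exact: autP. Qed.

Lemma aut_1mul : right_id aut_one aut_mul.
Proof. by move=> f; exact: autP. Qed.

Lemma aut_mulV : left_inverse aut_one aut_inv aut_mul.
Proof. by move=> f; apply: autP => x; exact: autK. Qed.

Lemma aut_Vmul : right_inverse aut_one aut_inv aut_mul.
Proof. by move=> f; apply: autP => x; exact: aut_invK. Qed.

HB.instance Definition _ := isGroup.Build Aut
  aut_mulA aut_mul1 aut_1mul aut_mulV aut_Vmul.

Definition inner (a : G) : Aut.
Proof.
apply: (@MkAut (fun x => a * x / a)).
  by move=> x y; rewrite !mulgA mulgVK.
by exists (fun x => a^-1 * x * a) => x; rewrite !mulgA ?mulVg ?mulgV mul1g
  ?mulgK ?mulgVK.
Defined.

Definition Inn_set : set Aut := range inner.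

Lemma Inn_is_subgroup : is_subgroup Inn_set.
Proof.
split; first by exists 1 => //; apply: autP => x /=; rewrite mul1g invg1 mulg1.
move=> _ _ [a _ <-] [b _ <-]; exists (a / b) => //.
apply/(canRL (mulgK _))/autP => x /=.
by rewrite invgF !mulgA !mulgVK.
Qed.

Lemma Inn_conj (f g : Aut) : Inn_set g -> Inn_set (g ^ f).
Proof.
case=> a _ <-; exists (f^-1 a) => //; apply: autP => x.
apply: (bij_inj (aut_bij f)).
have fV y : f (f^-1 y) = y by exact: aut_invK.
have -> : (inner a ^ f) x = f^-1 (a * f x / a) by [].
have -> : inner (f^-1 a) x = f^-1 a * x / f^-1 a by [].
have fN y : f y^-1 = (f y)^-1 by exact: gmulfV.
by rewrite fV !autM fN fV.
Qed.

Definition Inn : normal_subgroup Aut := NormalSubgroup Inn_is_subgroup Inn_conj.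

Definition Out : groupType := quotient_group Inn.

Definition out_map : UMagmaMorphism.type Aut Out := coset_map Inn.

Lemma out_map_surj (q : Out) : exists f, out_map f = q.
Proof. exact: coset_map_surj. Qed.

End Automorphisms.

(* Main.v *)
Require Import Defs.
From mathcomp Require Import all_boot.
From mathcomp Require Import boolp classical_sets functions cardinality.

(** Write out for the projection of Aut(G) onto Out(G), and let F be the group
    of automorphisms of G that fix H pointwise.

    The image of F in Out(G) has finite index. Indeed Aut(G) permutes the
    finitely many conjugacy classes of finite subgroups of G; if f and g send
    H into the same class, then out(g)^-1 * out(f) is represented by an
    automorphism t that maps the finite set H into itself, and there are only
    finitely many possible restrictions of t to H
    ([finite_index_out_aut_fixing]).

    The kernel of out on F is finite: the conjugation by a fixes H pointwise
    exactly when a centralizes H ([finite_inner_aut_fixing]).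

    By a theorem of Baumslag, Aut(G) is residually finite
    ([residually_finite_Aut]): the automorphisms that induce the identity on
    G / N, for N normal of finite index, form a subgroup of finite index,
    because an automorphism modulo N is determined by its values on a finite
    generating set. So Aut(G) has a subgroup R of finite index that meets the
    finite kernel above trivially.

    Then out is injective on D = F `&` R, and out(D) still has finite index in
    Out(G) ([finite_index_imageI]). The inverse of out on out(D) is the virtual
    splitting ([splits_virtually_image]), and Out(G) is residually finite
    because out(D) is isomorphic to a subgroup of the residually finite group
    Aut(G) ([residually_finite_image]). *)

Set Implicit Arguments.
Unset Strict Implicit.
Unset Printing Implicit Defensive.

Local Open Scope classical_set_scope.
Local Open Scope group_scope.

(** * Relations with finitely many classes *)

(** For an equivalence relation this says that the quotient is finite. Stating
    it through an invariant u lets finiteness arguments be combined relation by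
    relation, without choosing representatives or exhibiting function spaces;
    u only has to be at least as fine as R. *)
Definition finitely_classified (X : Type) (R : X -> X -> Prop) : Prop :=
  exists (U : Type) (u : X -> U),
    finite_set (range u) /\ forall x y, u x = u y -> R x y.

Lemma finitely_classified_range (X U : Type) (u : X -> U) (E : set U) :
  finite_set E -> (forall x, E (u x)) ->
  finitely_classified (fun x y => u x = u y).
Proof.
move=> Efin uE; exists U, u; split => //.
by apply: sub_finite_set Efin => _ [x _ <-].
Qed.

Lemma finitely_classifiedT (X : Type) :
  finitely_classified (fun _ _ : X => True).
Proof. by exists unit, (fun=> tt). Qed.

Lemma finitely_classifiedW (X : Type) (R S : X -> X -> Prop) :
  (forall x y, R x y -> S x y) ->
  finitely_classified R -> finitely_classified S.
Proof.
by move=> RS [U [u [ufin uR]]]; exists U, u; split => // x y /uR/RS.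
Qed.

Lemma finitely_classified_preim (X Y : Type) (f : X -> Y)
    (R : Y -> Y -> Prop) :
  finitely_classified R -> finitely_classified (fun x y => R (f x) (f y)).
Proof.
move=> [U [u [ufin uR]]]; exists U, (u \o f); split; last by move=> x y /uR.
by apply: sub_finite_set ufin => _ [x _ <-]; exists (f x).
Qed.

Lemma finitely_classified_and (X : Type) (R S : X -> X -> Prop) :
  finitely_classified R -> finitely_classified S ->
  finitely_classified (fun x y => R x y /\ S x y).
Proof.
move=> [U [u [ufin uR]]] [V [v [vfin vS]]].
exists (U * V)%type, (fun x => (u x, v x)); split.
  apply: sub_finite_set (finite_setX ufin vfin) => _ [x _ <-].
  by split; exists x.
by move=> x y [/uR Rxy /vS Sxy].
Qed.

(** The counting of functions on a finite set: a map out of D into finite sets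
    is known once its finitely many values are. *)
Lemma finitely_classified_forall (X : Type) (I : eqType) (D : set I)
    (R : I -> X -> X -> Prop) :
  finite_set D -> (forall i, D i -> finitely_classified (R i)) ->
  finitely_classified (fun x y => forall i, D i -> R i x y).
Proof.
move=> /finite_seqP[s ->]; elim: s => [|i s IHs] Rfin.
  by apply: finitely_classifiedW (finitely_classifiedT X).
have Rs : finitely_classified (fun x y => forall j, [set` s] j -> R j x y).
  by apply: IHs => j /= js; apply: Rfin; rewrite /= inE js orbT.
have Ri : finitely_classified (R i) by apply: Rfin; rewrite /= inE eqxx.
apply: finitely_classifiedW (finitely_classified_and Ri Rs).
by move=> x y [Rixy Rsxy] j /=; rewrite inE => /predU1P[->//|]; apply: Rsxy.
Qed.

(** * Subgroups of finite index *)

Lemma subgroupV (G : groupType) (A : set G) x :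
  is_subgroup A -> A x -> A x^-1.
Proof. by move=> [A1 AF] Ax; rewrite -[x^-1]mul1g; apply: AF. Qed.

Lemma subgroupM (G : groupType) (A : set G) x y :
  is_subgroup A -> A x -> A y -> A (x * y).
Proof.
by move=> sA Ax /(subgroupV sA) Ay; rewrite -[y]invgK; apply: sA.2.
Qed.

Lemma is_subgroupI (G : groupType) (A B : set G) :
  is_subgroup A -> is_subgroup B -> is_subgroup (A `&` B).
Proof.
move=> sA sB; split; first by split; [apply: sA.1 | apply: sB.1].
by move=> x y [Ax Bx] [Ay By]; split; [apply: sA.2 | apply: sB.2].
Qed.

Lemma is_subgroup_image (A B : groupType) (f : UMagmaMorphism.type A B)
    (D : set A) :
  is_subgroup D -> is_subgroup (f @` D).
Proof.
move=> sD; split; first by exists 1; [exact: sD.1 | exact: gmulf1].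
move=> _ _ [x Dx <-] [y Dy <-]; exists (x / y); last by rewrite gmulfF.
exact: sD.2.
Qed.

Lemma finite_index_reps (G : groupType) (A : set G) :
  is_subgroup A -> finite_index A ->
  exists2 Z : set G, finite_set Z & forall x, exists2 z, Z z & A (x^-1 * z).
Proof.
move=> sA Afin; exists (xget 1 @` range (fun x : G => [set x * a | a in A])).
  exact: finite_image.
move=> x; exists (xget 1 [set x * a | a in A]).
  by exists [set x * a | a in A].
have [a Aa <-] : [set x * a | a in A] (xget 1 [set x * a | a in A]).
  by apply: xgetPex; exists x, 1; [exact: sA.1 | rewrite mulg1].
by rewrite mulKg.
Qed.

Lemma finite_indexP (G : groupType) (A : set G) : is_subgroup A ->
  finite_index A <-> finitely_classified (fun x y => A (x^-1 * y)).
Proof.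
move=> sA; split=> [Afin|[U [u [ufin uA]]]].
  exists (set G), (fun x => [set x * a | a in A]); split => // x y xy.
  have [a Aa <-] : [set x * a | a in A] y.
    by rewrite xy; exists 1; [exact: sA.1 | rewrite mulg1].
  by rewrite mulKg.
pose coset x := [set x * a | a in A].
have cosetE x y : A (x^-1 * y) -> coset x = coset y.
  move=> Axy; apply/seteqP; split=> _ [a Aa <-].
    exists ((x^-1 * y)^-1 * a);
      first exact: (subgroupM sA (subgroupV sA Axy) Aa).
    by rewrite -[y in y * _](mulVKg x) mulgA mulgK.
  exists ((x^-1 * y) * a); first exact: subgroupM.
  by rewrite !mulgA mulgV mul1g.
have := finite_image (fun v => coset (xget 1 (u @^-1` [set v]))) ufin.
apply: sub_finite_set => _ [x _ <-]; exists (u x); first by exists x.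
by apply/cosetE/uA; apply: (@xgetPex _ 1 (u @^-1` [set u x])); exists x.
Qed.

Lemma finite_indexI (G : groupType) (A B : set G) :
  is_subgroup A -> is_subgroup B ->
  finite_index A -> finite_index B -> finite_index (A `&` B).
Proof.
move=> sA sB /(finite_indexP sA) Afin /(finite_indexP sB) Bfin.
exact/(finite_indexP (is_subgroupI sA sB))/finitely_classified_and.
Qed.

(** The core of A is the intersection of its conjugates. The conjugate of A by
    y depends only on the coset of y, so finitely many of them suffice. *)
Lemma finite_index_normal_core (G : groupType) (A : set G) :
  is_subgroup A -> finite_index A ->
  exists2 N : normal_subgroup G,
    finite_index (normal_set N) & normal_set N `<=` A.
Proof.
move=> sA Afin; pose core := [set x | forall y, A (x ^ y)].
have sC : is_subgroup core.
  split=> [y|x y Cx Cy z]; first by rewrite conj1g; exact: sA.1.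
  by rewrite conjMg conjVg; apply: sA.2.
have nC x a : core a -> core (a ^ x) by move=> Ca y; rewrite -conjgM.
exists (NormalSubgroup sC nC) => [|x /(_ 1)]; last by rewrite conjg1.
apply/(finite_indexP sC).
have [Z Zfin ZP] := finite_index_reps sA Afin.
have /(finitely_classified_forall Zfin) : forall z, Z z ->
    finitely_classified (fun x y => A ((x * z)^-1 * (y * z))).
  move=> z _; have := (finite_indexP sA).1 Afin.
    exact: (finitely_classified_preim (fun x => x * z)).
apply: finitely_classifiedW => x y AZ w; have [z Zz Awz] := ZP w.
have -> : (x^-1 * y) ^ w =
    (w^-1 * z) * ((x * z)^-1 * (y * z)) * (w^-1 * z)^-1.
  by rewrite /conjg !invgM invgK !mulgA !mulgK.
by apply: sA.2 => //; apply: subgroupM => //; apply: AZ.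
Qed.

(** Write b in B as z * f d, with z in a finite set of representatives of the
    cosets of f(D) and d in D. The coset of b modulo the image of D `&` R is
    determined by z and by the coset of d modulo R. *)
Lemma finite_index_imageI (A B : groupType) (f : UMagmaMorphism.type A B)
    (D R : set A) :
  is_subgroup D -> is_subgroup R -> finite_index R ->
  finite_index (f @` D) -> finite_index (f @` (D `&` R)).
Proof.
move=> sD sR Rfin fDfin; have sfD := is_subgroup_image f sD.
have [Z Zfin ZP] := finite_index_reps sfD fDfin.
have /choice[p pP] : forall b, exists p : B * A,
    [/\ Z p.1, D p.2 & f p.2 = p.1^-1 * b].
  move=> b; have [z Zz [d Dd fd]] := ZP b.
  exists (z, d^-1); split=> //=; first exact: subgroupV.
  by rewrite gmulfV fd invgM invgK.
apply/(finite_indexP (is_subgroup_image f (is_subgroupI sD sR))).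
have p1fin : finitely_classified (fun b c => (p b).1 = (p c).1).
  by apply: finitely_classified_range Zfin _ => b; have [] := pP b.
have p2fin : finitely_classified (fun b c => R ((p b).2^-1 * (p c).2)).
  have := (finite_indexP sR).1 Rfin.
  exact: (finitely_classified_preim (fun b => (p b).2)).
apply: finitely_classifiedW (finitely_classified_and p1fin p2fin).
move=> b c [pbc Rbc]; have [_ Db fb] := pP b; have [_ Dc fc] := pP c.
exists ((p b).2^-1 * (p c).2).
  by split => //; apply: subgroupM => //; apply: subgroupV.
by rewrite gmulfM gmulfV fb fc pbc invgM invgK mulgA mulgK.
Qed.

(** * Residual finiteness *)

Lemma residually_finiteP (G : groupType) :
  residually_finite G <->
  forall x : G, x <> 1 -> exists A, [/\ is_subgroup A, finite_index A & ~ A x].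
Proof.
rewrite /residually_finite; split=> [Gres x x1|Gres].
  apply: contrapT => noA; apply: x1.
  suff: [set 1] x by [].
  rewrite -Gres => A [sA Afin]; apply: contrapT => nAx.
  by apply: noA; exists A.
apply/seteqP; split=> [x capx|_ -> A [sA _]]; last exact: sA.1.
apply: contrapT => /Gres[A [sA Afin]]; apply; exact: capx.
Qed.

Lemma residually_finite_avoid (G : groupType) (K : set G) :
  residually_finite G -> finite_set K ->
  exists A, [/\ is_subgroup A, finite_index A &
    forall x, K x -> A x -> x = 1].
Proof.
move=> /residually_finiteP Gres /finite_seqP[s ->].
elim: s => [|k s [A [sA Afin AP]]].
  have sT : is_subgroup [set: G] by [].
  exists setT; split => //; apply/finite_indexP => //.
  exact: finitely_classifiedT.
have [k1|/eqP/Gres[B [sB Bfin nBk]]] := eqVneq k 1.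
  exists A; split => // x /=; rewrite inE => /predU1P[->//|]; exact: AP.
exists (A `&` B); split; [exact: is_subgroupI | exact: finite_indexI |].
by move=> x /=; rewrite inE => /predU1P[-> []//|xs [Ax _]]; apply: AP.
Qed.

(** A nontrivial b outside f(D) is excluded by f(D) itself. If b = f a with a
    in D, some R of finite index in A excludes a, and since f is injective on D
    the image of D `&` R excludes b. *)
Lemma residually_finite_image (A B : groupType)
    (f : UMagmaMorphism.type A B) (D : set A) :
  is_subgroup D -> finite_index (f @` D) ->
  (forall x, D x -> f x = 1 -> x = 1) ->
  residually_finite A -> residually_finite B.
Proof.
move=> sD fDfin finj /residually_finiteP Ares; apply/residually_finiteP => b b1.
have [[a Da fa]|nDb] := pselect ((f @` D) b); last first.
  by exists (f @` D); split => //; exact: is_subgroup_image.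
have a1 : a <> 1 by move=> a1; apply: b1; rewrite -fa a1 gmulf1.
have [R [sR Rfin nRa]] := Ares _ a1.
exists (f @` (D `&` R)); split.
- by apply: is_subgroup_image; apply: is_subgroupI.
- exact: finite_index_imageI.
move=> [c [Dc Rc] fc]; apply: nRa.
have /divg1_eq -> // : a / c = 1.
by apply: finj; [exact: sD.2 | rewrite gmulfF fa fc mulgV].
Qed.

Lemma splits_virtually_image (A B : groupType)
    (f : UMagmaMorphism.type A B) (D : set A) :
  is_subgroup D -> finite_index (f @` D) ->
  (forall x, D x -> f x = 1 -> x = 1) ->
  splits_virtually f.
Proof.
move=> sD fDfin finj.
have injD x y : D x -> D y -> f x = f y -> x = y.
  move=> Dx Dy fxy; apply: divg1_eq; apply: finj; first exact: sD.2.
  by rewrite gmulfF fxy mulgV.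
exists (f @` D); split => //; first exact: is_subgroup_image.
pose g b := xget 1 [set a | D a /\ f a = b].
have gP b : (f @` D) b -> D (g b) /\ f (g b) = b.
  by move=> [a Da fa]; apply: (@xgetPex _ 1 [set a | D a /\ f a = b]); exists a.
exists g; split=> [x y fDx fDy|x /gP[]//].
have [Dx fx] := gP _ fDx; have [Dy fy] := gP _ fDy.
have [Dxy fxy] := gP _ (subgroupM (is_subgroup_image f sD) fDx fDy).
by apply: injD => //; [exact: subgroupM | rewrite gmulfM fx fy].
Qed.

(** * Automorphisms of finitely generated residually finite groups *)

Lemma autVK (G : groupType) (f : Aut G) (x : G) : f (f^-1 x) = x.
Proof. exact: aut_invK. Qed.

Lemma autKV (G : groupType) (f : Aut G) (x : G) : f^-1 (f x) = x.
Proof. exact: autK. Qed.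

(** Two homomorphisms into G / N agree on a subgroup, hence everywhere as soon
    as they agree on generators. *)
Lemma is_subgroup_congruent (G : groupType) (N : normal_subgroup G)
    (f g : Aut G) :
  is_subgroup [set x | normal_set N ((f x)^-1 * g x)].
Proof.
split=> [|x y /= Nx Ny].
  by rewrite /= !aut1 invg1 mulg1; exact: (normal_is_subgroup N).1.
have -> : (f (x / y))^-1 * g (x / y) =
    ((f x)^-1 * g x) ^ (f y)^-1 * (((f y)^-1 * g y)^-1) ^ (g y)^-1.
  by rewrite !gmulfF /conjg !invgM !invgK !mulgA mulgK mulgVK.
by apply: normalM; apply: normal_conj => //; apply: normalV.
Qed.

(** The stabilizer of the projection of G onto G / N, under the action of Aut(G)
    by precomposition on homomorphisms from G to G / N. *)
Definition aut_trivial_mod (G : groupType) (N : normal_subgroup G) :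
    set (Aut G) :=
  [set f | forall x, normal_set N (x^-1 * f x)].

Lemma is_subgroup_aut_trivial_mod (G : groupType) (N : normal_subgroup G) :
  is_subgroup (aut_trivial_mod N).
Proof.
split=> [x|f g Sf Sg x].
  by rewrite mulVg; exact: (normal_is_subgroup N).1.
have Ny := Sg (g^-1 x); rewrite autVK in Ny.
have -> : x^-1 * (f / g) x = ((g^-1 x)^-1 * x)^-1 * ((g^-1 x)^-1 * f (g^-1 x)).
  by rewrite invgM invgK mulgA mulgK.
by apply: normalM => //; apply: normalV.
Qed.

(** The orbit of the projection of G onto G / N is finite, because a
    homomorphism to G / N is determined by its values on the finitely many
    generators. *)
Lemma finite_index_aut_trivial_mod (G : groupType) (N : normal_subgroup G) :
  finitely_generated G -> finite_index (normal_set N) ->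
  finite_index (aut_trivial_mod N).
Proof.
move=> [S [Sfin Sgen]] Nfin.
apply/(finite_indexP (is_subgroup_aut_trivial_mod N)).
(* Precomposition is a right action, whence the inverses: f and g lie in the
   same left coset when f^-1 and g^-1 agree modulo N. *)
have /(finitely_classified_forall Sfin) : forall s, S s ->
    finitely_classified
      (fun f g : Aut G => normal_set N ((f^-1 s)^-1 * g^-1 s)).
  move=> s _; have := (finite_indexP (normal_is_subgroup N)).1 Nfin.
  exact: (finitely_classified_preim (fun f : Aut G => f^-1 s)).
apply: finitely_classifiedW => f g fgS x.
have : smallest is_subgroup S (g x) by rewrite Sgen.
move=> /(smallest_sub (is_subgroup_congruent N f^-1 g^-1) fgS)/normalV.
by rewrite [g^-1 _]autKV invgM invgK.
Qed.

(** Baumslag's theorem. If f moves x, a normal subgroup N of finite index that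
    avoids x^-1 * f x shows that f acts nontrivially modulo N. *)
Lemma residually_finite_Aut (G : groupType) :
  finitely_generated G -> residually_finite G -> residually_finite (Aut G).
Proof.
move=> Gfg /residually_finiteP Gres; apply/residually_finiteP => f f1.
have [x xfx] : exists x, f x <> x.
  apply: contrapT => /forallNP fid; apply/f1/autP => x.
  exact: contrapT (fid x).
have /Gres[A [sA Afin nAfx]] : x^-1 * f x <> 1.
  by move=> /mulg1_eq; rewrite invgK => /esym.
have [N Nfin NA] := finite_index_normal_core sA Afin.
exists (aut_trivial_mod N); split.
- exact: is_subgroup_aut_trivial_mod.
- exact: finite_index_aut_trivial_mod.
by move=> /(_ x)/NA.
Qed.

(** * Automorphisms fixing a finite subgroup *)

Definition aut_fixing (G : groupType) (H : set G) : set (Aut G) :=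
  [set f | forall h, H h -> f h = h].

Lemma is_subgroup_aut_fixing (G : groupType) (H : set G) :
  is_subgroup (aut_fixing H).
Proof.
split=> // f g fH gH h Hh.
have gVh : g^-1 h = h by rewrite -{1}(gH h Hh) autKV.
by rewrite -[RHS](fH h Hh) -[in RHS]gVh.
Qed.

Lemma out_map_inner (G : groupType) (a : G) : out_map G (inner a) = 1.
Proof.
by apply/eqP/(@coset_mapP (Aut G) (Inn G)); exists a => //; rewrite divg1.
Qed.

Lemma out_map_eq1 (G : groupType) (f : Aut G) :
  out_map G f = 1 -> exists a, f = inner a.
Proof.
move=> /eqP/(@coset_mapP (Aut G) (Inn G)).
by rewrite divg1 => -[a _ <-]; exists a.
Qed.

Lemma finite_inner_aut_fixing (G : groupType) (H : set G) :
  finite_set (centralizer H) ->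
  finite_set [set f | aut_fixing H f /\ out_map G f = 1].
Proof.
move=> /(finite_image (@inner G)); apply: sub_finite_set => f [fH].
move=> /out_map_eq1[a fa]; exists a => // h Hh.
by rewrite /commute -{2}(fH h Hh) fa /= mulgVK.
Qed.

(** If g(H) is the conjugate of f(H) by x, then g^-1, the conjugation taking
    f(H) to g(H), and f compose to an automorphism that preserves H; the
    conjugation is invisible in Out(G). *)
Lemma conj_class_eq_correction (G : groupType) (H : set G) (f g : Aut G) :
  conj_class (f @` H) = conj_class (g @` H) ->
  exists t : Aut G, (forall h, H h -> H (t h)) /\
    out_map G t = (out_map G g)^-1 * out_map G f.
Proof.
move=> fg; have [x _ xfg] : conj_class (f @` H) (g @` H).
  rewrite fg; exists 1 => //; apply/seteqP; split=> [_ [k ? <-]|k ?].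
    by rewrite conjg1.
  by exists k => //; rewrite conjg1.
exists (g^-1 * (inner x^-1 * f)); split=> [h Hh|]; last first.
  by rewrite !gmulfM gmulfV out_map_inner mul1g.
have [k Hk gk] : (g @` H) (f h ^ x).
  by rewrite -xfg; exists (f h) => //; exists h.
suff -> : (g^-1 * (inner x^-1 * f)) h = k by [].
have -> : (g^-1 * (inner x^-1 * f)) h = g^-1 (x^-1 * f h / x^-1) by [].
by rewrite -(autKV g k) gk /conjg invgK mulgA.
Qed.

(** A class q in Out(G) sends H into some conjugacy class c; correct q by an
    automorphism chosen once for each c, so that it preserves H. The coset of q
    is then determined by c and by the restriction to H of the corrected
    automorphism, for which there are finitely many possibilities. *)
Lemma finite_index_out_aut_fixing (G : groupType) (H : set G) :
  is_subgroup H -> finite_set H ->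
  finitely_many_classes_of_finite_subgroups G ->
  finite_index (out_map G @` aut_fixing H).
Proof.
move=> sH Hfin clfin.
pose cl (f : Aut G) := conj_class (f @` H).
pose rep c := xget 1 [set f | cl f = c].
have /choice[p pP] : forall q : Out G, exists p : set (set G) * Aut G,
    [/\ range cl p.1, forall h, H h -> H (p.2 h) &
        out_map G p.2 = (out_map G (rep p.1))^-1 * q].
  move=> q; have [f <-] := out_map_surj q.
  have repf : cl (rep (cl f)) = cl f.
    by apply: (@xgetPex _ 1 [set g | cl g = cl f]); exists f.
  have [t [tH outt]] := conj_class_eq_correction (esym repf).
  by exists (cl f, t); split => //; exists f.
apply/(finite_indexP (is_subgroup_image _ (is_subgroup_aut_fixing H))).
have p1fin : finitely_classified (fun q r => (p q).1 = (p r).1).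
  apply: finitely_classified_range clfin _ => q; have [[f _ <-] _ _] := pP q.
  exists (f @` H) => //.
  by split; [exact: is_subgroup_image | exact: finite_image].
have p2fin : finitely_classified
    (fun q r => forall h, H h -> (p q).2 h = (p r).2 h).
  apply: finitely_classified_forall => // h Hh.
  by apply: finitely_classified_range Hfin _ => q; have [_ /(_ h Hh)] := pP q.
apply: finitely_classifiedW (finitely_classified_and p1fin p2fin).
move=> q r [qr1 qr2]; have [_ _ outq] := pP q; have [_ _ outr] := pP r.
exists ((p q).2^-1 * (p r).2).
  move=> h Hh.
  have -> : ((p q).2^-1 * (p r).2) h = (p q).2^-1 ((p r).2 h) by [].
  by rewrite -qr2 // autKV.
by rewrite gmulfM gmulfV outq outr qr1 invgM invgK mulgA mulgK.
Qed.

Theorem theorem1 (G : groupType) (H : set G) :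
  finitely_generated G ->
  residually_finite G ->
  is_subgroup H ->
  finite_set H ->
  finite_set (centralizer H) ->
  finitely_many_classes_of_finite_subgroups G ->
  splits_virtually (out_map G) /\ residually_finite (Out G).
Proof.
move=> Gfg Gres sH Hfin CHfin clfin.
have AutGres := residually_finite_Aut Gfg Gres.
have [R [sR Rfin RP]] :=
  residually_finite_avoid AutGres (finite_inner_aut_fixing CHfin).
have sF := is_subgroup_aut_fixing H.
pose D := aut_fixing H `&` R.
have sD : is_subgroup D by exact: is_subgroupI.
have outDfin : finite_index (out_map G @` D).
  exact: finite_index_imageI (finite_index_out_aut_fixing sH Hfin clfin).
have outDinj f : D f -> out_map G f = 1 -> f = 1.
  by move=> [fH Rf] outf; apply: RP.
by split; [exact: splits_virtually_image outDinj
  | exact: residually_finite_image outDinj AutGres].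
Qed.
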